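(* Let $T$ be a hermitian asymmetric triple isomorphism of $\mathbb O$. Define $\widetilde{T}_j:C_6\to C_6$ for $j=1,2,3$ by (for $\alpha,\beta,\gamma\in\mathbb C$, $a,b,c\in\mathbb O$) $$\widetilde{T}_1\begin{pmatrix} \alpha & a & b \\ a^\diamond & \beta & c \\ b^\diamond & c^\diamond & \gamma \end{pmatrix}=\begin{pmatrix} \alpha & T(a) & T(1)\boxdot T(b^\diamond)^\diamond \\ T(a)^\diamond & \beta & T(c^\diamond)^\diamond \\ T(b^\diamond)\boxdot T(1)^\diamond & T(c^\diamond) & \gamma \end{pmatrix},$$ $$\widetilde{T}_2\begin{pmatrix} \alpha & a & b \\ a^\diamond & \beta & c \\ b^\diamond & c^\diamond & \gamma \end{pmatrix}=\begin{pmatrix} \alpha & T(a^\diamond)^\diamond & T(b^\diamond)^\diamond \\ T(a^\diamond) & \beta & T(c)\boxdot T(1)^\diamond \\ T(b^\diamond) & T(1)\boxdot T(c)^\diamond & \gamma \end{pmatrix},$$ $$\widetilde{T}_3\begin{pmatrix} \alpha & a & b \\ a^\diamond & \beta & c \\ b^\diamond & c^\diamond & \gamma \end{pmatrix}=\begin{pmatrix} \alpha & T(a)\boxdot T(1)^\diamond & T(b) \\ T(1)\boxdot T(a)^\diamond & \beta & T(c) \\ T(b)^\diamond & T(c)^\diamond & \gamma \end{pmatrix}.$$ Then $\widetilde{T}_1,\widetilde{T}_2,\widetilde{T}_3$ are Jordan $*$-automorphisms of $C_6$.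
   Context: Cayley–Dickson algebras: $\mathcal A_0=\mathbb C$ with its usual product, $x^{\diamond}=x$, $x^*=\overline{x}$. Inductively $\mathcal A_{n+1}=\mathcal A_n\times\mathcal A_n$ with $\overline{(x_1,x_2)}=(\overline{x_1},\overline{x_2})$, $(x_1,x_2)^{\diamond}=(x_1^{\diamond},-x_2)$, $(x_1,x_2)^*=(x_1^*,-\overline{x_2})$ and $(x_1,x_2)\boxdot(y_1,y_2)=(x_1\boxdot y_1-y_2\boxdot x_2^{\diamond},\ x_1^{\diamond}\boxdot y_2+y_1\boxdot x_2)$. Complex octonions: $\mathbb O=\mathcal A_3$; $a\in\mathcal A_n$ is identified with $(a,0)\in\mathcal A_{n+1}$. A complex-linear bijection $T:\mathbb O\to\mathbb O$ is a hermitian asymmetric triple isomorphism if $T((x\boxdot y^* )\boxdot z)=(T(x)\boxdot T(y)^* )\boxdot T(z)$ for all $x,y,z\in\mathbb O$ and $T(\overline x)=\overline{T(x)}$ for all $x\in\mathbb O$. For matrices over $\mathbb O$: $(x^\diamond)_{ij}=(x_{ji})^\diamond$, $(x^* )_{ij}=(x_{ji})^*$, and $\boxdot$ is the usual matrix product. The Cartan factor of type 6 is the JB$^*$-algebra $C_6=H_3(\mathbb O)=\{x\in M_3(\mathbb O): x^{\diamond}=x\}$ with Jordan product $x\circ y=\frac12(x\boxdot y+y\boxdot x)$ and involution $^*$. A Jordan $*$-automorphism is a complex-linear bijection preserving $\circ$ and $^*$. *)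

(* Defs.v *)
(* The complex numbers are R[i] for a real field R : realType. *)
From HB Require Import structures.
From mathcomp Require Import all_boot all_order all_algebra.
From mathcomp Require Import reals complex.

Set Implicit Arguments.
Unset Strict Implicit.
Unset Printing Implicit Defensive.

Import Order.TTheory GRing.Theory Num.Theory.

Local Open Scope ring_scope.

Section CayleyDickson.
Variable R : realType.
Local Notation C := R[i].

(* CD n is built from C by n doublings, so CD 0 is C itself and dim_C (CD n) = 2 ^ n.
   Its componentwise module structure is declared on CD, with operations defined by
   recursion on n, rather than inherited from nested products of modules: the classes
   of the latter unfold to intractably large terms already for n = 3. *)
Fixpoint cdtype (n : nat) : Type := if n is m.+1 then (cdtype m * cdtype m)%type else C.

Definition CD (n : nat) : Type := cdtype n.

Fact CD_hasDecEq n : hasDecEq (CD n).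
Proof.
elim: n => [|n IH]; first exact: (hasDecEq.Build (CD 0) (@eqP C)).
pose E : eqType := HB.pack (CD n) IH.
exact: (hasDecEq.Build (CD n.+1) (@eqP (E * E)%type)).
Qed.

HB.instance Definition _ n := CD_hasDecEq n.

Fact CD_hasChoice n : hasChoice (CD n).
Proof.
elim: n => [|n IH]; first exact: (Choice.on C).
pose E : choiceType := HB.pack (CD n) IH.
exact: (Choice.on (E * E)%type).
Qed.

HB.instance Definition _ n := CD_hasChoice n.

Fixpoint cdzero (n : nat) : CD n :=
  match n return CD n with
  | 0 => 0 : C
  | m.+1 => (cdzero m, cdzero m)
  end.

Fixpoint cdopp (n : nat) : CD n -> CD n :=
  match n return CD n -> CD n with
  | 0 => fun x => - (x : C)
  | m.+1 => fun x : (CD m * CD m)%type => (cdopp x.1, cdopp x.2)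
  end.

Fixpoint cdadd (n : nat) : CD n -> CD n -> CD n :=
  match n return CD n -> CD n -> CD n with
  | 0 => fun x y => (x : C) + (y : C)
  | m.+1 => fun x y : (CD m * CD m)%type => (cdadd x.1 y.1, cdadd x.2 y.2)
  end.

Fixpoint cdscale (n : nat) (a : C) : CD n -> CD n :=
  match n return CD n -> CD n with
  | 0 => fun x => a * (x : C)
  | m.+1 => fun x : (CD m * CD m)%type => (cdscale a x.1, cdscale a x.2)
  end.

Fact cdaddA n : associative (@cdadd n).
Proof.
elim: n => [|n IH] x y z; first exact: addrA.
by case: x y z => x1 x2 [y1 y2] [z1 z2]; congr (_, _); apply: IH.
Qed.

Fact cdaddC n : commutative (@cdadd n).
Proof.
elim: n => [|n IH] x y; first exact: addrC.
by case: x y => x1 x2 [y1 y2]; congr (_, _); apply: IH.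
Qed.

Fact cdadd0 n : left_id (cdzero n) (@cdadd n).
Proof.
elim: n => [|n IH] x; first exact: add0r.
by case: x => x1 x2; congr (_, _); apply: IH.
Qed.

Fact cdaddN n : left_inverse (cdzero n) (@cdopp n) (@cdadd n).
Proof.
elim: n => [|n IH] x; first exact: addNr.
by case: x => x1 x2; congr (_, _); apply: IH.
Qed.

HB.instance Definition _ n := GRing.isZmodule.Build (CD n)
  (@cdaddA n) (@cdaddC n) (@cdadd0 n) (@cdaddN n).

Fact cdscaleA n a b (x : CD n) : cdscale a (cdscale b x) = cdscale (a * b) x.
Proof.
elim: n x => [|n IH] x; first exact: mulrA.
by case: x => x1 x2; congr (_, _); apply: IH.
Qed.

Fact cdscale1 n : left_id 1 (@cdscale n).
Proof.
elim: n => [|n IH] x; first exact: mul1r.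
by case: x => x1 x2; congr (_, _); apply: IH.
Qed.

Fact cdscaleDr n : right_distributive (@cdscale n) +%R.
Proof.
elim: n => [|n IH] a x y; first exact: mulrDr.
by case: x y => x1 x2 [y1 y2]; congr (_, _); apply: IH.
Qed.

Fact cdscaleDl n (x : CD n) : {morph @cdscale n ^~ x : a b / a + b}.
Proof.
elim: n x => [|n IH] x a b; first exact: mulrDl.
by case: x => x1 x2; congr (_, _); apply: IH.
Qed.

HB.instance Definition _ n := GRing.Zmodule_isLmodule.Build C (CD n)
  (@cdscaleA n) (@cdscale1 n) (@cdscaleDr n) (@cdscaleDl n).

Fixpoint cdconj (n : nat) : CD n -> CD n :=
  match n return CD n -> CD n with
  | 0 => fun x => conjc (x : C)
  | m.+1 => fun x : (CD m * CD m)%type => (cdconj x.1, cdconj x.2)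
  end.

Fixpoint cddiam (n : nat) : CD n -> CD n :=
  match n return CD n -> CD n with
  | 0 => fun x => x
  | m.+1 => fun x : (CD m * CD m)%type => (cddiam x.1, - x.2)
  end.

Fixpoint cdstar (n : nat) : CD n -> CD n :=
  match n return CD n -> CD n with
  | 0 => fun x => conjc (x : C)
  | m.+1 => fun x : (CD m * CD m)%type => (cdstar x.1, - cdconj x.2)
  end.

Fixpoint cdmul (n : nat) : CD n -> CD n -> CD n :=
  match n return CD n -> CD n -> CD n with
  | 0 => fun x y => (x : C) * (y : C)
  | m.+1 => fun x y : (CD m * CD m)%type =>
      (cdmul x.1 y.1 - cdmul y.2 (cddiam x.2),
       cdmul (cddiam x.1) y.2 + cdmul y.1 x.2)
  end.

(* The identification of a in CD n with (a, 0) in CD n.+1, iterated from CD 0 = C. *)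
Fixpoint cdscal (n : nat) (a : C) : CD n :=
  match n return CD n with
  | 0 => a
  | m.+1 => (cdscal m a, 0) : (CD m * CD m)%type
  end.

Definition cdone (n : nat) : CD n := cdscal n 1.

End CayleyDickson.

Notation octonion R := (CD R 3).

Arguments cdconj {R n} x.
Arguments cddiam {R n} x.
Arguments cdstar {R n} x.
Arguments cdmul {R n} x y.
Arguments cdscal {R n} a.
Arguments cdone {R n}.
Arguments cdconj : simpl never.
Arguments cddiam : simpl never.
Arguments cdstar : simpl never.
Arguments cdmul : simpl never.
Arguments cdscal : simpl never.

Declare Scope cd_scope.
Delimit Scope cd_scope with CD.
Notation "x ^conj" := (cdconj x) (at level 2, format "x ^conj") : cd_scope.
Notation "x ^dia" := (cddiam x) (at level 2, format "x ^dia") : cd_scope.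
Notation "x ^star" := (cdstar x) (at level 2, format "x ^star") : cd_scope.
Notation "x [.] y" := (cdmul x y) (at level 40, left associativity) : cd_scope.
Local Open Scope cd_scope.

Section CDTheory.
Variable R : realType.

Definition cdpair n (x1 x2 : CD R n) : CD R n.+1 := (x1, x2).

Lemma cdpairW n (P : CD R n.+1 -> Prop) :
  (forall x1 x2, P (cdpair x1 x2)) -> forall x, P x.
Proof. by move=> H [x1 x2]; apply: H. Qed.

Lemma cdpair_inj n (x1 x2 y1 y2 : CD R n) :
  cdpair x1 x2 = cdpair y1 y2 -> x1 = y1 /\ x2 = y2.
Proof. by case. Qed.

Section CDPair.
Variable n : nat.
Implicit Types x y : CD R n.

Lemma cdpairD x1 x2 y1 y2 :
  cdpair x1 x2 + cdpair y1 y2 = cdpair (x1 + y1) (x2 + y2).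
Proof. by []. Qed.

Lemma cdpairN x1 x2 : - cdpair x1 x2 = cdpair (- x1) (- x2).
Proof. by []. Qed.

Lemma cdpairZ (a : R[i]) x1 x2 : a *: cdpair x1 x2 = cdpair (a *: x1) (a *: x2).
Proof. by []. Qed.

Lemma cdconj_pair x1 x2 : (cdpair x1 x2)^conj = cdpair x1^conj x2^conj.
Proof. by []. Qed.

Lemma cddiam_pair x1 x2 : (cdpair x1 x2)^dia = cdpair x1^dia (- x2).
Proof. by []. Qed.

Lemma cdstar_pair x1 x2 : (cdpair x1 x2)^star = cdpair x1^star (- x2^conj).
Proof. by []. Qed.

Lemma cdmul_pair x1 x2 y1 y2 :
  cdpair x1 x2 [.] cdpair y1 y2 =
  cdpair (x1 [.] y1 - y2 [.] x2^dia) (x1^dia [.] y2 + y1 [.] x2).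
Proof. by []. Qed.

Lemma cdscal_pair (a : R[i]) : cdscal a = cdpair (cdscal a : CD R n) 0.
Proof. by []. Qed.

Definition cdpairE := (cdpairD, cdpairN, cdpairZ, cdconj_pair, cddiam_pair,
  cdstar_pair, cdmul_pair, cdscal_pair).

End CDPair.

Lemma cdconjN n (x : CD R n) : (- x)^conj = - x^conj.
Proof.
elim: n x => [|m IH] x; first exact: rmorphN.
by elim/cdpairW: x => x1 x2; rewrite !cdpairE !IH.
Qed.

Lemma cddiamZD n (a : R[i]) (x y : CD R n) : (a *: x + y)^dia = a *: x^dia + y^dia.
Proof.
elim: n x y => [|m IH] x y //.
elim/cdpairW: x => x1 x2; elim/cdpairW: y => y1 y2.
by rewrite !cdpairE IH opprD scalerN.
Qed.

Lemma cddiamD n (x y : CD R n) : (x + y)^dia = x^dia + y^dia.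
Proof. by have := cddiamZD 1 x y; rewrite !scale1r. Qed.

Lemma cddiam0 n : (0 : CD R n)^dia = 0.
Proof. by apply: (addrI (0^dia)); rewrite -cddiamD !addr0. Qed.

Lemma cddiamZ n (a : R[i]) (x : CD R n) : (a *: x)^dia = a *: x^dia.
Proof. by have := cddiamZD a x 0; rewrite cddiam0 !addr0. Qed.

Lemma cddiamN n (x : CD R n) : (- x)^dia = - x^dia.
Proof. by rewrite -scaleN1r cddiamZ scaleN1r. Qed.

Lemma cddiamK n (x : CD R n) : x^dia^dia = x.
Proof.
elim: n x => [|m IH] x //.
by elim/cdpairW: x => x1 x2; rewrite !cdpairE IH opprK.
Qed.

Lemma cddiam_star n (x : CD R n) : x^dia^star = x^star^dia.
Proof.
elim: n x => [|m IH] x //.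
by elim/cdpairW: x => x1 x2; rewrite !cdpairE IH cdconjN.
Qed.

Lemma cddiam_scal n (a : R[i]) : (cdscal a : CD R n)^dia = cdscal a.
Proof. by elim: n => [|m IH] //; rewrite !cdpairE IH oppr0. Qed.

Lemma cdmul_linear n :
  [/\ forall x y z : CD R n, (x + y) [.] z = x [.] z + y [.] z,
      forall x y z : CD R n, x [.] (y + z) = x [.] y + x [.] z,
      forall x y : CD R n, (- x) [.] y = - (x [.] y) &
      forall x y : CD R n, x [.] (- y) = - (x [.] y)].
Proof.
elim: n => [|m [IHl IHr IHNl IHNr]].
  split=> *; [exact: mulrDl | exact: mulrDr | exact: mulNr | exact: mulrN].
split.
- move=> x y z; elim/cdpairW: x => x1 x2; elim/cdpairW: y => y1 y2.
  elim/cdpairW: z => z1 z2.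
  rewrite !cdpairE !cddiamD !(IHl, IHr) opprD.
  by congr (cdpair _ _); rewrite addrACA.
- move=> x y z; elim/cdpairW: x => x1 x2; elim/cdpairW: y => y1 y2.
  elim/cdpairW: z => z1 z2.
  rewrite !cdpairE !(IHl, IHr) opprD.
  by congr (cdpair _ _); rewrite addrACA.
- move=> x y; elim/cdpairW: x => x1 x2; elim/cdpairW: y => y1 y2.
  by rewrite !cdpairE !cddiamN !(IHNl, IHNr) !opprD.
- move=> x y; elim/cdpairW: x => x1 x2; elim/cdpairW: y => y1 y2.
  by rewrite !cdpairE !(IHNl, IHNr) !opprD.
Qed.

Lemma cddiamM n (x y : CD R n) : (x [.] y)^dia = y^dia [.] x^dia.
Proof.
elim: n x y => [|m IH] x y; first exact: mulrC.
have [_ _ HNl HNr] := cdmul_linear m.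
elim/cdpairW: x => x1 x2; elim/cdpairW: y => y1 y2.
rewrite !cdpairE !(cddiamD, cddiamN, IH, cddiamK) !(HNl, HNr) opprK opprD.
by congr (cdpair _ _); rewrite addrC.
Qed.

Lemma cddiam_fix n (x : CD R n) : x^dia = x -> exists a : R[i], x = cdscal a.
Proof.
elim: n x => [|m IH] x; first by exists x.
elim/cdpairW: x => x1 x2; rewrite cddiam_pair => /cdpair_inj [/IH [a ->]] /eqP.
rewrite eq_sym -subr_eq0 opprK -mulr2n -scaler_nat scaler_eq0 pnatr_eq0 /=.
by move=> /eqP ->; exists a.
Qed.

End CDTheory.

(* 'M[V] has no lmodType structure for a module V of entries, and CD R n is
   not a ring, so scaling and matrix product are spelled out entrywise. *)
Section CDMatrix.
Variables (R : realType) (n : nat).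
Local Notation A := (CD R n).

Definition mxscale m p (a : R[i]) (x : 'M[A]_(m, p)) : 'M[A]_(m, p) :=
  \matrix_(i, j) (a *: x i j).

Definition mxdiam m p (x : 'M[A]_(m, p)) : 'M[A]_(p, m) :=
  \matrix_(i, j) (x j i)^dia.

Definition mxstar m p (x : 'M[A]_(m, p)) : 'M[A]_(p, m) :=
  \matrix_(i, j) (x j i)^star.

Definition mxcdmul m p q (x : 'M[A]_(m, p)) (y : 'M[A]_(p, q)) : 'M[A]_(m, q) :=
  \matrix_(i, j) \sum_k x i k [.] y k j.

Definition diam_herm m : {pred 'M[A]_m} := fun x => mxdiam x == x.
Arguments diam_herm m x : clear implicits.

Lemma diam_hermP m (x : 'M[A]_m) :
  reflect (forall i j, (x i j)^dia = x j i) (x \in diam_herm m).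
Proof.
apply: (iffP eqP) => [E i j | E]; first by rewrite -[in RHS]E mxE.
by apply/matrixP => i j; rewrite mxE E.
Qed.

Fact diam_herm_zmod_closed m : zmod_closed (diam_herm m).
Proof.
split=> [|x y /diam_hermP Hx /diam_hermP Hy].
  by apply/diam_hermP => i j; rewrite !mxE; exact: cddiam0.
by apply/diam_hermP => i j; rewrite !mxE cddiamD cddiamN Hx Hy.
Qed.

HB.instance Definition _ m :=
  GRing.isZmodClosed.Build 'M[A]_m (diam_herm m) (diam_herm_zmod_closed m).

Lemma diam_herm_scale m a (x : 'M[A]_m) :
  x \in diam_herm m -> mxscale a x \in diam_herm m.
Proof.
by move=> /diam_hermP Hx; apply/diam_hermP => i j; rewrite !mxE cddiamZ Hx.
Qed.

Lemma diam_herm_star m (x : 'M[A]_m) :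
  x \in diam_herm m -> mxstar x \in diam_herm m.
Proof.
by move=> /diam_hermP Hx; apply/diam_hermP => i j; rewrite !mxE -cddiam_star Hx.
Qed.

Definition mxjordan m (x y : 'M[A]_m) : 'M[A]_m :=
  mxscale 2^-1 (mxcdmul x y + mxcdmul y x).

Lemma diam_herm_jordan m (x y : 'M[A]_m) :
  x \in diam_herm m -> y \in diam_herm m -> mxjordan x y \in diam_herm m.
Proof.
move=> /diam_hermP Hx /diam_hermP Hy; apply: diam_herm_scale.
have E (u v : 'M[A]_m) : (forall i j, (u i j)^dia = u j i) ->
    (forall i j, (v i j)^dia = v j i) ->
    forall i j, (mxcdmul u v i j)^dia = mxcdmul v u j i.
  move=> Hu Hv i j; rewrite !mxE.
  rewrite (big_morph _ (@cddiamD R n) (@cddiam0 R n)).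
  by apply: eq_bigr => k _; rewrite cddiamM Hu Hv.
apply/diam_hermP => i j; rewrite mxE cddiamD (E x y) // (E y x) //.
by rewrite [RHS]mxE addrC.
Qed.

End CDMatrix.

Arguments diam_herm R n m x : clear implicits.

(* H_m(A_n), the diamond-hermitian m x m matrices over A_n = CD R n *)
Section DiamHerm.
Variables (R : realType) (n m : nat).
Local Notation C := R[i].

Record hermmx : predArgType := HermMx {
  hermmx_val :> 'M[CD R n]_m;
  hermmxP : hermmx_val \in diam_herm R n m
}.

HB.instance Definition _ := [isSub for hermmx_val].
HB.instance Definition _ := [Choice of hermmx by <:].
HB.instance Definition _ := [SubChoice_isSubZmodule of hermmx by <:].

Definition hermmx_scale (a : C) (x : hermmx) : hermmx :=
  HermMx (diam_herm_scale a (hermmxP x)).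

Fact hermmx_scaleA a b x : hermmx_scale a (hermmx_scale b x) = hermmx_scale (a * b) x.
Proof. by apply/val_inj/matrixP => i j; rewrite !mxE scalerA. Qed.
Fact hermmx_scale1 : left_id 1 hermmx_scale.
Proof. by move=> x; apply/val_inj/matrixP => i j; rewrite !mxE scale1r. Qed.
Fact hermmx_scaleDr : right_distributive hermmx_scale +%R.
Proof. by move=> a x y; apply/val_inj/matrixP => i j; rewrite !mxE scalerDr. Qed.
Fact hermmx_scaleDl x : {morph hermmx_scale^~ x : a b / a + b}.
Proof. by move=> a b; apply/val_inj/matrixP => i j; rewrite !mxE scalerDl. Qed.

HB.instance Definition _ := GRing.Zmodule_isLmodule.Build C hermmx
  hermmx_scaleA hermmx_scale1 hermmx_scaleDr hermmx_scaleDl.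

Definition hermmx_jordan (x y : hermmx) : hermmx :=
  HermMx (diam_herm_jordan (hermmxP x) (hermmxP y)).

Definition hermmx_star (x : hermmx) : hermmx := HermMx (diam_herm_star (hermmxP x)).

Definition jordan_star_automorphism (F : hermmx -> hermmx) : Prop :=
  [/\ linear F, bijective F,
      forall x y, F (hermmx_jordan x y) = hermmx_jordan (F x) (F y) &
      forall x, F (hermmx_star x) = hermmx_star (F x)].

End DiamHerm.

Notation C6 R := (hermmx R 3 3).

(* The default value x00 of nth is never reached. *)
Definition mx33 (V : Type) (x00 x01 x02 x10 x11 x12 x20 x21 x22 : V) : 'M[V]_3 :=
  \matrix_(i, j) nth x00 (nth [::] [:: [:: x00; x01; x02];
                                       [:: x10; x11; x12];
                                       [:: x20; x21; x22]] i) j.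

Section Mx33Theory.
Variable V : Type.

Lemma ord3P (P : 'I_3 -> Prop) : P 0 -> P 1 -> P 2 -> forall i, P i.
Proof.
move=> P0 P1 P2 [[|[|[|//]]] lti]; [move: P0 | move: P1 | move: P2];
  by congr P; apply: val_inj.
Qed.

Lemma mx3P (x y : 'M[V]_3) :
    x 0 0 = y 0 0 -> x 0 1 = y 0 1 -> x 0 2 = y 0 2 ->
    x 1 0 = y 1 0 -> x 1 1 = y 1 1 -> x 1 2 = y 1 2 ->
    x 2 0 = y 2 0 -> x 2 1 = y 2 1 -> x 2 2 = y 2 2 ->
  x = y.
Proof. by move=> *; apply/matrixP; apply: ord3P; apply: ord3P. Qed.

Lemma mx33E (x00 x01 x02 x10 x11 x12 x20 x21 x22 : V) :
  let x := mx33 x00 x01 x02 x10 x11 x12 x20 x21 x22 in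
  ((x 0 0 = x00) * (x 0 1 = x01) * (x 0 2 = x02) *
   (x 1 0 = x10) * (x 1 1 = x11) * (x 1 2 = x12) *
   (x 2 0 = x20) * (x 2 1 = x21) * (x 2 2 = x22))%type.
Proof. by do !split; rewrite mxE. Qed.

End Mx33Theory.

Section CartanFactor6.
Variable R : realType.
Local Notation C := R[i].
Local Notation O := (octonion R).
Local Notation C6 := (C6 R).

Definition hermitian_asym_triple_iso (T : O -> O) : Prop :=
  [/\ linear T, bijective T,
      forall x y z, T ((x [.] y^star) [.] z) = (T x [.] (T y)^star) [.] T z &
      forall x, T (x^conj) = (T x)^conj].

Lemma mx33_herm x00 x01 x02 x10 x11 x12 x20 x21 x22 :
    x00^dia = x00 -> x11^dia = x11 -> x22^dia = x22 ->
    x10 = x01^dia -> x20 = x02^dia -> x21 = x12^dia ->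
  mx33 x00 x01 x02 x10 x11 x12 x20 x21 x22 \in diam_herm R 3 3.
Proof.
move=> H0 H1 H2 -> -> ->; apply/diam_hermP.
by do 2!apply: ord3P; rewrite !mx33E // cddiamK.
Qed.

Definition herm3 (alpha beta gamma : C) (a b c : O) : C6 :=
  HermMx (@mx33_herm (cdscal alpha)       a             b
                        (a^dia)   (cdscal beta)       c
                        (b^dia)       (c^dia)   (cdscal gamma)
    (cddiam_scal 3 alpha) (cddiam_scal 3 beta) (cddiam_scal 3 gamma)
    erefl erefl erefl).

Lemma herm3P (x : C6) :
  exists alpha beta gamma a b c, x = herm3 alpha beta gamma a b c.
Proof.
have /diam_hermP Hx := hermmxP x.
have [alpha H0] := cddiam_fix (Hx 0 0).
have [beta H1] := cddiam_fix (Hx 1 1).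
have [gamma H2] := cddiam_fix (Hx 2 2).
exists alpha, beta, gamma, ((x : C6) 0 1), ((x : C6) 0 2), ((x : C6) 1 2).
by apply/val_inj/mx3P; rewrite mx33E // Hx.
Qed.

Variable T : O -> O.
Local Notation one := (cdone : O).

(* The entries alpha, beta, gamma, a, b, c of x are read off as x i i (i = 0, 1, 2),
   x 0 1, x 0 2 and x 1 2; Ttilde1E, Ttilde2E, Ttilde3E give the displayed formulas. *)
Definition Ttilde1_mx (x : 'M[O]_3) : 'M[O]_3 :=
  let a := x 0 1 in let b := x 0 2 in let c := x 1 2 in
  mx33 (x 0 0)                  (T a)          (T one [.] (T (b^dia))^dia)
       ((T a)^dia)              (x 1 1)        ((T (c^dia))^dia)
       (T (b^dia) [.] (T one)^dia)  (T (c^dia))    (x 2 2).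

Definition Ttilde2_mx (x : 'M[O]_3) : 'M[O]_3 :=
  let a := x 0 1 in let b := x 0 2 in let c := x 1 2 in
  mx33 (x 0 0)      ((T (a^dia))^dia)        ((T (b^dia))^dia)
       (T (a^dia))  (x 1 1)                  (T c [.] (T one)^dia)
       (T (b^dia))  (T one [.] (T c)^dia)    (x 2 2).

Definition Ttilde3_mx (x : 'M[O]_3) : 'M[O]_3 :=
  let a := x 0 1 in let b := x 0 2 in let c := x 1 2 in
  mx33 (x 0 0)                  (T a [.] (T one)^dia)  (T b)
       (T one [.] (T a)^dia)    (x 1 1)                (T c)
       ((T b)^dia)              ((T c)^dia)            (x 2 2).

Fact Ttilde1_herm (x : C6) : Ttilde1_mx x \in diam_herm R 3 3.
Proof.
have /diam_hermP Hx := hermmxP x.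
by apply: mx33_herm; rewrite ?Hx ?cddiamM ?cddiamK.
Qed.

Fact Ttilde2_herm (x : C6) : Ttilde2_mx x \in diam_herm R 3 3.
Proof.
have /diam_hermP Hx := hermmxP x.
by apply: mx33_herm; rewrite ?Hx ?cddiamM ?cddiamK.
Qed.

Fact Ttilde3_herm (x : C6) : Ttilde3_mx x \in diam_herm R 3 3.
Proof.
have /diam_hermP Hx := hermmxP x.
by apply: mx33_herm; rewrite ?Hx ?cddiamM ?cddiamK.
Qed.

Definition Ttilde1 (x : C6) : C6 := HermMx (Ttilde1_herm x).
Definition Ttilde2 (x : C6) : C6 := HermMx (Ttilde2_herm x).
Definition Ttilde3 (x : C6) : C6 := HermMx (Ttilde3_herm x).

Lemma Ttilde1E alpha beta gamma a b c :
  Ttilde1 (herm3 alpha beta gamma a b c) =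
  mx33 (cdscal alpha)               (T a)          (T one [.] (T (b^dia))^dia)
       ((T a)^dia)                  (cdscal beta)  ((T (c^dia))^dia)
       (T (b^dia) [.] (T one)^dia)  (T (c^dia))    (cdscal gamma) :> 'M[O]_3.
Proof. by rewrite [LHS]/= /Ttilde1_mx !mx33E. Qed.

Lemma Ttilde2E alpha beta gamma a b c :
  Ttilde2 (herm3 alpha beta gamma a b c) =
  mx33 (cdscal alpha)  ((T (a^dia))^dia)      ((T (b^dia))^dia)
       (T (a^dia))     (cdscal beta)          (T c [.] (T one)^dia)
       (T (b^dia))     (T one [.] (T c)^dia)  (cdscal gamma) :> 'M[O]_3.
Proof. by rewrite [LHS]/= /Ttilde2_mx !mx33E. Qed.

Lemma Ttilde3E alpha beta gamma a b c :
  Ttilde3 (herm3 alpha beta gamma a b c) =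
  mx33 (cdscal alpha)         (T a [.] (T one)^dia)  (T b)
       (T one [.] (T a)^dia)  (cdscal beta)          (T c)
       ((T b)^dia)            ((T c)^dia)            (cdscal gamma) :> 'M[O]_3.
Proof. by rewrite [LHS]/= /Ttilde3_mx !mx33E. Qed.

End CartanFactor6.

(* Main.v *)
(* Since T commutes with the conjugation, the triple product may be taken to be
   (x y^dia) z. Comparing T (x, x, x) with n(x) T x shows that T is an isometry
   of the norm n, so u = T 1 is a real element of norm 1, and inserting 1 in each
   argument of the triple product gives
     T (x z) = (T x u^dia) (T z),
     T (y^dia z) = (u (T y)^dia) (T z),
     T (x y^dia) u^dia = (T x) (T y)^dia.
   On the other hand, applying real isometries f, g, h to the entries a, b, c of
   an element of C6 is a Jordan *-automorphism as soon as
     f (b c^dia) = (g b) (h c)^dia, g (a c) = (f a) (h c), h (a^dia b) = (f a)^dia (g b),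
   and for each of the three maps these conditions are, up to dia, the three
   identities for T. *)
Require Import Defs.
From mathcomp Require Import all_boot all_order all_algebra.
From mathcomp Require Import reals complex.
From mathcomp Require Import ring.

Set Implicit Arguments.
Unset Strict Implicit.
Unset Printing Implicit Defensive.

Import Order.TTheory GRing.Theory Num.Theory.
Local Open Scope ring_scope.
Local Open Scope cd_scope.

(** * Cayley-Dickson algebras: bilinearity, conjugations and the norm form *)

Section CayleyDicksonTheory.
Variable R : realType.
Implicit Type n : nat.

Lemma cdmulDl n (x y z : CD R n) : (x + y) [.] z = x [.] z + y [.] z.
Proof. by have [-> _ _ _] := cdmul_linear R n. Qed.

Lemma cdmulDr n (x y z : CD R n) : x [.] (y + z) = x [.] y + x [.] z.
Proof. by have [_ -> _ _] := cdmul_linear R n. Qed.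

Lemma cdmulNl n (x y : CD R n) : (- x) [.] y = - (x [.] y).
Proof. by have [_ _ -> _] := cdmul_linear R n. Qed.

Lemma cdmulNr n (x y : CD R n) : x [.] (- y) = - (x [.] y).
Proof. by have [_ _ _ ->] := cdmul_linear R n. Qed.

Lemma cdmul0l n (x : CD R n) : 0 [.] x = 0.
Proof. by apply: (addrI (0 [.] x)); rewrite -cdmulDl !addr0. Qed.

Lemma cdmul0r n (x : CD R n) : x [.] 0 = 0.
Proof. by apply: (addrI (x [.] 0)); rewrite -cdmulDr !addr0. Qed.

Lemma cdscaleE n (a : R[i]) (x : CD R n) :
  (cdscal a [.] x = a *: x) * (x [.] cdscal a = a *: x).
Proof.
elim: n x => [|n IH] x; first by split; [|exact: (mulrC (x : R[i]) a)].
elim/cdpairW: x => x1 x2.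
by rewrite !cdpairE cddiam_scal cddiam0 !IH !(cdmul0l, cdmul0r) subr0 add0r addr0.
Qed.

Lemma cdmul1l n (x : CD R n) : cdone [.] x = x.
Proof. by rewrite cdscaleE scale1r. Qed.

Lemma cdmul1r n (x : CD R n) : x [.] cdone = x.
Proof. by rewrite cdscaleE scale1r. Qed.

Lemma cddiam1 n : (cdone : CD R n)^dia = cdone.
Proof. exact: cddiam_scal. Qed.

Lemma cdmulZ n (a : R[i]) (x y : CD R n) :
  ((a *: x) [.] y = a *: (x [.] y)) * (x [.] (a *: y) = a *: (x [.] y)).
Proof.
elim: n x y => [|n IH] x y.
  split.
    change ((a * (x : R[i])) * (y : R[i]) = a * ((x : R[i]) * (y : R[i]))).
    by rewrite mulrA.
  change ((x : R[i]) * (a * (y : R[i])) = a * ((x : R[i]) * (y : R[i]))).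
  exact: mulrCA.
elim/cdpairW: x => x1 x2; elim/cdpairW: y => y1 y2.
by rewrite !cdpairE !cddiamZ !IH scalerBr scalerDr.
Qed.

Lemma cdscalD n (a b : R[i]) : cdscal (a + b) = cdscal a + cdscal b :> CD R n.
Proof. by elim: n => [|n IH] //; rewrite !cdpairE IH addr0. Qed.

Lemma cdscal_inj n : injective (@cdscal R n).
Proof. by elim: n => [|n IH] a b //; rewrite !cdpairE => /cdpair_inj [/IH]. Qed.

Lemma cdconjD n (x y : CD R n) : (x + y)^conj = x^conj + y^conj.
Proof.
elim: n x y => [|n IH] x y; first exact: rmorphD.
by elim/cdpairW: x => x1 x2; elim/cdpairW: y => y1 y2; rewrite !cdpairE !IH.
Qed.

Lemma cdconj0 n : (0 : CD R n)^conj = 0.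
Proof. by apply: (addrI (0^conj)); rewrite -cdconjD !addr0. Qed.

Lemma cdconjK n (x : CD R n) : x^conj^conj = x.
Proof.
elim: n x => [|n IH] x; first exact: conjcK.
by elim/cdpairW: x => x1 x2; rewrite !cdpairE !IH.
Qed.

Lemma cdconj_diam n (x : CD R n) : x^dia^conj = x^conj^dia.
Proof.
elim: n x => [|n IH] x //.
by elim/cdpairW: x => x1 x2; rewrite !cdpairE IH cdconjN.
Qed.

Lemma cdstarE n (x : CD R n) : x^star = x^conj^dia.
Proof.
elim: n x => [|n IH] x //.
by elim/cdpairW: x => x1 x2; rewrite !cdpairE IH.
Qed.

Lemma cdconjM n (x y : CD R n) : (x [.] y)^conj = x^conj [.] y^conj.
Proof.
elim: n x y => [|n IH] x y; first exact: rmorphM.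
elim/cdpairW: x => x1 x2; elim/cdpairW: y => y1 y2.
by rewrite !cdpairE !(cdconjD, cdconjN, IH, cdconj_diam).
Qed.

Lemma cdconj1 n : (cdone : CD R n)^conj = cdone.
Proof.
elim: n => [|n IH]; first exact: rmorph1.
by rewrite /cdone !cdpairE IH cdconj0.
Qed.

(** The complex quadratic form n(x), a sum of squares of the 2^n coordinates without complex
    conjugation; it can vanish at nonzero elements. *)
Fixpoint cdnorm n : CD R n -> R[i] :=
  match n return CD R n -> R[i] with
  | 0 => fun x => (x : R[i]) * x
  | m.+1 => fun x : (CD R m * CD R m)%type => cdnorm x.1 + cdnorm x.2
  end.

Lemma cdnorm_pair n (x1 x2 : CD R n) :
  cdnorm (cdpair x1 x2) = cdnorm x1 + cdnorm x2.
Proof. by []. Qed.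

Lemma cdnormN n (x : CD R n) : cdnorm (- x) = cdnorm x.
Proof.
elim: n x => [|n IH] x; first exact: mulrNN.
by elim/cdpairW: x => x1 x2; rewrite cdpairN !cdnorm_pair !IH.
Qed.

Lemma cdnorm_diam n (x : CD R n) : cdnorm x^dia = cdnorm x.
Proof.
elim: n x => [|n IH] x //.
by elim/cdpairW: x => x1 x2; rewrite cddiam_pair !cdnorm_pair cdnormN IH.
Qed.

(** On a pair, the second component of the product is - x1^dia x2 + x1^dia x2, which vanishes. *)
Lemma cdmul_diam n (x : CD R n) : x [.] x^dia = cdscal (cdnorm x).
Proof.
elim: n x => [|n IH] x //.
elim/cdpairW: x => x1 x2; rewrite !cdpairE cdnorm_pair cdscalD -!IH.
by rewrite cdmulNl cdmulNr opprK addNr.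
Qed.

Lemma cdmul_diamV n (x : CD R n) : x^dia [.] x = cdscal (cdnorm x).
Proof. by rewrite -[x in _ [.] x]cddiamK cdmul_diam cdnorm_diam. Qed.

(** Exposes the operations on coordinates as those of the field [R[i]], so that [ring] can work with
    them. *)
Lemma cd0E :
  (forall x y : CD R 0, x + y = (x : R[i]) + (y : R[i])) *
  (forall x : CD R 0, - x = - (x : R[i])) *
  (forall x y : CD R 0, x [.] y = (x : R[i]) * (y : R[i])) *
  (forall (a : R[i]) (x : CD R 0), a *: x = a * (x : R[i])) *
  (forall x : CD R 0, x^dia = x) *
  (forall x : CD R 0, cdnorm x = (x : R[i]) * (x : R[i])).
Proof. by []. Qed.

Lemma octonion_ind8 (P : octonion R -> Prop) :
  (forall x0 x1 x2 x3 x4 x5 x6 x7 : CD R 0,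
     P (cdpair (cdpair (cdpair x0 x1) (cdpair x2 x3))
               (cdpair (cdpair x4 x5) (cdpair x6 x7)))) -> forall x, P x.
Proof.
move=> H; elim/cdpairW => x y.
elim/cdpairW: x => x x'; elim/cdpairW: y => y y'.
elim/cdpairW: x => x0 x1; elim/cdpairW: x' => x2 x3.
by elim/cdpairW: y => y0 y1; elim/cdpairW: y' => y2 y3.
Qed.

(** Degen's eight-square identity, a polynomial identity in the sixteen coordinates. *)
Lemma cdnormM (x y : octonion R) : cdnorm (x [.] y) = cdnorm x * cdnorm y.
Proof.
elim/octonion_ind8: x => x0 x1 x2 x3 x4 x5 x6 x7.
elim/octonion_ind8: y => y0 y1 y2 y3 y4 y5 y6 y7.
rewrite !cdpairE !cdnorm_pair !cd0E.
ring.
Qed.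

(** A form of alternativity, special to low dimension; it is checked on each of the eight
    coordinates. *)
Lemma cdmulK (x y : octonion R) : (y [.] x) [.] x^dia = cdnorm x *: y.
Proof.
elim/octonion_ind8: x => x0 x1 x2 x3 x4 x5 x6 x7.
elim/octonion_ind8: y => y0 y1 y2 y3 y4 y5 y6 y7.
rewrite !cdpairE !cdnorm_pair !cd0E.
by do 3!congr cdpair; ring.
Qed.

Lemma cdmulVK (x y : octonion R) : x^dia [.] (x [.] y) = cdnorm x *: y.
Proof.
apply: (can_inj (@cddiamK R 3)).
by rewrite !cddiamM cdmulK cdnorm_diam cddiamZ.
Qed.

(** Polarization of [cdmul_diam]: the symmetrized product depends on the norm only, so every
    additive isometry preserves it. *)
Lemma cdnorm_polar n (x y : CD R n) :
  x [.] y^dia + y [.] x^dia =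
    cdscal (cdnorm (x + y)) - cdscal (cdnorm x) - cdscal (cdnorm y).
Proof.
rewrite -!cdmul_diam cddiamD !(cdmulDl, cdmulDr).
by rewrite -(addrA (x [.] x^dia)) (addrC (x [.] x^dia)) addrK addrA addrK.
Qed.

Lemma cdnorm_polarV n (x y : CD R n) :
  x^dia [.] y + y^dia [.] x =
    cdscal (cdnorm (x + y)) - cdscal (cdnorm x) - cdscal (cdnorm y).
Proof.
by have := cdnorm_polar x^dia y^dia; rewrite !cddiamK -cddiamD !cdnorm_diam.
Qed.

End CayleyDicksonTheory.

Arguments cdnorm {R n} x : simpl never.

(** * Real isometries of the octonions *)

Section OctonionIsometry.
Variable R : realType.
Local Notation O := (octonion R).
Implicit Types f g : O -> O.

Definition conj_isometry f : Prop :=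
  [/\ linear f, bijective f, forall x, cdnorm (f x) = cdnorm x &
      forall x, f x^conj = (f x)^conj].

Section Theory.
Variable f : O -> O.
Hypothesis Hf : conj_isometry f.

Lemma conj_isometryD : {morph f : x y / x + y}.
Proof. by move=> x y; have [L _ _ _] := Hf; have := L 1 x y; rewrite !scale1r. Qed.

Lemma conj_isometryZ a x : f (a *: x) = a *: f x.
Proof.
have f0 : f 0 = 0 by apply: (addrI (f 0)); rewrite -conj_isometryD !addr0.
by have [L _ _ _] := Hf; have := L a x 0; rewrite f0 !addr0.
Qed.

Lemma conj_isometryZl a x : f (cdscal a [.] x) = cdscal a [.] f x.
Proof. by rewrite !cdscaleE conj_isometryZ. Qed.

Lemma conj_isometryZr a x : f (x [.] cdscal a) = f x [.] cdscal a.
Proof. by rewrite !cdscaleE conj_isometryZ. Qed.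

Lemma conj_isometry_polar x y :
  f x [.] (f y)^dia + f y [.] (f x)^dia = x [.] y^dia + y [.] x^dia.
Proof. by have [_ _ N _] := Hf; rewrite !cdnorm_polar -conj_isometryD !N. Qed.

Lemma conj_isometry_polarV x y :
  (f x)^dia [.] f y + (f y)^dia [.] f x = x^dia [.] y + y^dia [.] x.
Proof. by have [_ _ N _] := Hf; rewrite !cdnorm_polarV -conj_isometryD !N. Qed.

End Theory.

Lemma conj_isometry_comp f g :
  conj_isometry f -> conj_isometry g -> conj_isometry (f \o g).
Proof.
move=> [Lf Bf Nf Cf] [Lg Bg Ng Cg]; split=> [a x y||x|x] /=.
- by rewrite Lg Lf.
- exact: bij_comp.
- by rewrite Nf Ng.
- by rewrite Cg Cf.
Qed.

Lemma conj_isometry_diam : conj_isometry cddiam.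
Proof.
split=> [a x y||x|x].
- exact: cddiamZD.
- by exists cddiam; exact: cddiamK.
- exact: cdnorm_diam.
- by rewrite cdconj_diam.
Qed.

(** Multiplicativity of the norm gives the isometry, and left multiplication by [u^dia] is the
    inverse because n(u) = n(u^dia) = 1. *)
Lemma conj_isometry_mull (u : O) :
  cdnorm u = 1 -> u^conj = u -> conj_isometry (cdmul u).
Proof.
move=> Nu Cu; split=> [a x y||x|x].
- by rewrite cdmulDr cdmulZ.
- exists (cdmul u^dia) => x; first by rewrite cdmulVK Nu scale1r.
  by rewrite -{1}[u]cddiamK cdmulVK cdnorm_diam Nu scale1r.
- by rewrite cdnormM Nu mul1r.
- by rewrite cdconjM Cu.
Qed.

Lemma conj_isometry_mulr (u : O) :
  cdnorm u = 1 -> u^conj = u -> conj_isometry (fun x => x [.] u).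
Proof.
move=> Nu Cu; have Nud : cdnorm u^dia = 1 by rewrite cdnorm_diam.
have Cud : u^dia^conj = u^dia by rewrite cdconj_diam Cu.
(* Right multiplication by [u] is left multiplication by [u^dia] conjugated by the antiautomorphism
   dia. *)
have [L B N C] := conj_isometry_comp conj_isometry_diam
  (conj_isometry_comp (conj_isometry_mull Nud Cud) conj_isometry_diam).
have E x : x [.] u = (u^dia [.] x^dia)^dia by rewrite cddiamM !cddiamK.
split=> [a x y||x|x]; rewrite ?E //; first exact: L.
by apply: (eq_bij B) => x; rewrite E.
- exact: N.
- exact: C.
Qed.

End OctonionIsometry.

(** * Entrywise isometries acting on C6 *)

Section HermMap.
Variable R : realType.
Local Notation O := (octonion R).
Local Notation C6 := (C6 R).

Lemma sum_ord3 (V : nmodType) (F : 'I_3 -> V) : \sum_k F k = F 0 + F 1 + F 2.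
Proof.
rewrite !big_ord_recl big_ord0 addr0 addrA.
by congr (F _ + F _ + F _); apply: val_inj.
Qed.

Lemma hermmx3_eq (x y : C6) :
    x 0 0 = y 0 0 -> x 1 1 = y 1 1 -> x 2 2 = y 2 2 ->
    x 0 1 = y 0 1 -> x 0 2 = y 0 2 -> x 1 2 = y 1 2 ->
  x = y.
Proof.
move=> H0 H1 H2 Ha Hb Hc.
have /diam_hermP Hx := hermmxP x; have /diam_hermP Hy := hermmxP y.
by apply/val_inj/mx3P => //=; rewrite -Hx -Hy ?Ha ?Hb ?Hc.
Qed.

Fact hermmap_herm (f g h : O -> O) (x : C6) :
  mx33 (x 0 0)          (f (x 0 1))      (g (x 0 2))
       (f (x 0 1))^dia  (x 1 1)          (h (x 1 2))
       (g (x 0 2))^dia  (h (x 1 2))^dia  (x 2 2) \in diam_herm R 3 3.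
Proof. by have /diam_hermP Hx := hermmxP x; apply: mx33_herm. Qed.

(** The common shape of the three maps of the theorem, which allows them to be treated together. *)
Definition hermmap (f g h : O -> O) (x : C6) : C6 := HermMx (hermmap_herm f g h x).

Lemma hermmapE f g h (x : C6) (y := hermmap f g h x) :
  ((y 0 0 = x 0 0) * (y 1 1 = x 1 1) * (y 2 2 = x 2 2) *
   (y 0 1 = f (x 0 1)) * (y 0 2 = g (x 0 2)) * (y 1 2 = h (x 1 2)) *
   (y 1 0 = (f (x 0 1))^dia) * (y 2 0 = (g (x 0 2))^dia) *
   (y 2 1 = (h (x 1 2))^dia)).
Proof. by rewrite /y /=; do !split; rewrite mx33E. Qed.

Lemma hermmap_can f g h f' g' h' :
  cancel f f' -> cancel g g' -> cancel h h' ->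
  cancel (hermmap f g h) (hermmap f' g' h').
Proof. by move=> Kf Kg Kh x; apply: hermmx3_eq; rewrite !hermmapE. Qed.

Lemma hermmap_automorphism f g h :
    conj_isometry f -> conj_isometry g -> conj_isometry h ->
    (forall b c, f (b [.] c^dia) = g b [.] (h c)^dia) ->
    (forall a c, g (a [.] c) = f a [.] h c) ->
    (forall a b, h (a^dia [.] b) = (f a)^dia [.] g b) ->
  jordan_star_automorphism (hermmap f g h).
Proof.
move=> If Ig Ih Ef Eg Eh; split.
- have [Lf _ _ _] := If; have [Lg _ _ _] := Ig; have [Lh _ _ _] := Ih.
  have E a (x y : C6) i j : (a *: x + y : C6) i j = a *: x i j + y i j.
    by rewrite [LHS]mxE [X in X + _]mxE.
  by move=> a x y; apply: hermmx3_eq; rewrite E !hermmapE E ?Lf ?Lg ?Lh.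
- have [_ [f' Kf K'f] _ _] := If; have [_ [g' Kg K'g] _ _] := Ig.
  have [_ [h' Kh K'h] _ _] := Ih.
  by exists (hermmap f' g' h'); exact: hermmap_can.
- move=> x y.
  have [x0 [x1 [x2 [a [b [c ->]]]]]] := herm3P x.
  have [y0 [y1 [y2 [a' [b' [c' ->]]]]]] := herm3P y.
  have add3ACA (u1 u2 u3 v1 v2 v3 : O) :
      u1 + u2 + u3 + (v1 + v2 + v3) = u1 + v1 + (u2 + v2) + (u3 + v3).
    by rewrite addrACA (addrACA u1).
  have M (u v : 'M[O]_3) i j : mxcdmul u v i j =
      u i 0 [.] v 0 j + u i 1 [.] v 1 j + u i 2 [.] v 2 j.
    by rewrite mxE sum_ord3.
  have J (u v : C6) i j : hermmx_jordan u v i j =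
      2^-1 *: (mxcdmul u v i j + mxcdmul v u i j) by rewrite [LHS]mxE [X in _ *: X]mxE.
  apply: hermmx3_eq; rewrite hermmapE !J !M !hermmapE !mx33E.
  (* On the diagonal, pairing the summands of xy with those of yx leaves polarized norms, which
     isometries preserve. *)
  + by rewrite !add3ACA !(conj_isometry_polar If) !(conj_isometry_polar Ig).
  + by rewrite !add3ACA !(conj_isometry_polarV If) !(conj_isometry_polar Ih).
  + by rewrite !add3ACA !(conj_isometry_polarV Ig) !(conj_isometry_polarV Ih).
  (* Off the diagonal, each entry of a product has two terms with a scalar factor, settled by
     linearity, and one product of octonions, settled by the matching hypothesis. *)
  + rewrite (conj_isometryZ If) !(conj_isometryD If).
    by rewrite !(conj_isometryZl If) !(conj_isometryZr If) !Ef.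
  + rewrite (conj_isometryZ Ig) !(conj_isometryD Ig).
    by rewrite !(conj_isometryZl Ig) !(conj_isometryZr Ig) !Eg.
  + rewrite (conj_isometryZ Ih) !(conj_isometryD Ih).
    by rewrite !(conj_isometryZl Ih) !(conj_isometryZr Ih) !Eh.
- have [_ _ _ Cf] := If; have [_ _ _ Cg] := Ig; have [_ _ _ Ch] := Ih.
  move=> x; have /diam_hermP Hx := hermmxP x.
  (* Star is conj followed by dia, and on a hermitian matrix dia undoes the transposition, so the
     involution is entrywise conj. *)
  have S (u : C6) i j : hermmx_star u i j = (u i j)^conj.
    by have /diam_hermP Hu := hermmxP u; rewrite mxE cdstarE -cdconj_diam Hu.
  by apply: hermmx3_eq; rewrite hermmapE !S !hermmapE.
Qed.

End HermMap.

(** * Consequences of the triple identity for T *)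

Section TripleIso.
Variables (R : realType) (T : octonion R -> octonion R).
Hypothesis HT : hermitian_asym_triple_iso T.
Local Notation u := (T cdone).

Lemma triple_iso_diam x y z : T ((x [.] y^dia) [.] z) = (T x [.] (T y)^dia) [.] T z.
Proof.
(* The middle argument is [y^conj] because its star is [y^dia]. *)
have [_ _ H C] := HT; have := H x y^conj z.
by rewrite !cdstarE -C cdconjK.
Qed.

Lemma triple_iso_isometry : conj_isometry T.
Proof.
have [L B H C] := HT; split=> // x.
have T0 : T 0 = 0.
  by apply: (addrI (T 0)); have := L 1 0 0; rewrite !scale1r !addr0.
have TZ a y : T (a *: y) = a *: T y by have := L a y 0; rewrite T0 !addr0.
have [-> | x_neq0] := eqVneq x 0; first by rewrite T0.
have Tx_neq0 : T x != 0 by rewrite -T0 (inj_eq (bij_inj B)).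
(* Both sides become multiples of [T x], by n(x) and n(T x); injectivity of [T] makes [T x] nonzero,
   so it cancels. *)
have := triple_iso_diam x x x; rewrite !cdmul_diam !cdscaleE TZ => /eqP.
by rewrite -subr_eq0 -scalerBl scaler_eq0 (negPf Tx_neq0) orbF subr_eq0 eq_sym => /eqP.
Qed.

Lemma triple_iso_conj1 : u^conj = u.
Proof. by have [_ _ _ C] := HT; rewrite -C cdconj1. Qed.

Lemma triple_iso_norm1 : cdnorm u = 1.
Proof.
have [_ _ N _] := triple_iso_isometry; rewrite N.
apply: (@cdscal_inj R 3).
by rewrite -cdmul_diam cddiam1 cdmul1l.
Qed.

Lemma triple_iso_mul x z : T (x [.] z) = (T x [.] u^dia) [.] T z.
Proof. by rewrite -triple_iso_diam cddiam1 cdmul1r. Qed.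

Lemma triple_iso_mulV y z : T (y^dia [.] z) = (u [.] (T y)^dia) [.] T z.
Proof. by rewrite -triple_iso_diam cdmul1l. Qed.

(** Taking z = 1 leaves a right factor [u], which [u^dia] cancels since n(u) = 1. *)
Lemma triple_iso_mulr x y : T (x [.] y^dia) [.] u^dia = T x [.] (T y)^dia.
Proof.
by rewrite -[x [.] _]cdmul1r triple_iso_diam cdmulK triple_iso_norm1 scale1r.
Qed.

Lemma triple_iso_mull x y : u [.] (T (x [.] y^dia))^dia = T y [.] (T x)^dia.
Proof.
by rewrite -[LHS]cddiamK cddiamM cddiamK triple_iso_mulr cddiamM cddiamK.
Qed.

End TripleIso.

Theorem corollary7p3 (R : realType) (T : octonion R -> octonion R)
    (hT : hermitian_asym_triple_iso T) :
  [/\ jordan_star_automorphism (Ttilde1 T),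
      jordan_star_automorphism (Ttilde2 T) &
      jordan_star_automorphism (Ttilde3 T)].
Proof.
have IT := triple_iso_isometry hT.
have Id := conj_isometry_diam R.
have Idd := conj_isometry_comp Id (conj_isometry_comp IT Id).
have Nu := triple_iso_norm1 hT; have Cu := triple_iso_conj1 hT.
have Nud : cdnorm (T cdone)^dia = 1 by rewrite cdnorm_diam.
have Cud : (T cdone)^dia^conj = (T cdone)^dia by rewrite cdconj_diam Cu.
have Il := conj_isometry_mull Nu Cu; have Ir := conj_isometry_mulr Nud Cud.
(* Only the values of a map matter, so each of the three maps need only agree pointwise with a
   [hermmap]. *)
have ext (F G : C6 R -> C6 R) :
    F =1 G -> jordan_star_automorphism G -> jordan_star_automorphism F.
  move=> E [L B J S]; split.
  + by move=> a x y; rewrite !E L.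
  + by apply: (eq_bij B) => x; rewrite E.
  + by move=> x y; rewrite !E J.
  + by move=> x; rewrite !E S.
split.
(* Here f = T, g b = u T(b^dia)^dia and h c = T(c^dia)^dia. *)
- apply: ext (hermmap_automorphism IT (conj_isometry_comp Il Idd) Idd _ _ _).
  + by move=> x; apply: hermmx3_eq; rewrite hermmapE mx33E.
  + by move=> b c /=; rewrite cddiamK -(triple_iso_mulV hT) cddiamK.
  + by move=> a c /=; rewrite cddiamM (triple_iso_mull hT).
  + move=> a b /=; rewrite cddiamM cddiamK (triple_iso_mul hT).
    by rewrite !cddiamM cddiamK.
(* Here f and g are T conjugated by dia, and h c = T(c) u^dia. *)
- apply: ext (hermmap_automorphism Idd Idd (conj_isometry_comp Ir IT) _ _ _).
  + by move=> x; apply: hermmx3_eq; rewrite hermmapE mx33E.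
  + move=> b c /=; rewrite cddiamM cddiamK (triple_iso_mul hT).
    by rewrite !cddiamM cddiamK.
  + move=> a c /=; rewrite cddiamM (triple_iso_mulV hT).
    by rewrite !cddiamM cddiamK.
  + by move=> a b /=; rewrite cddiamK -{1}[b]cddiamK (triple_iso_mulr hT).
(* Here f a = T(a) u^dia and g = h = T, so the conditions are the three identities for T almost
   verbatim. *)
- apply: ext (hermmap_automorphism (conj_isometry_comp Ir IT) IT IT _ _ _).
  + by move=> x; apply: hermmx3_eq; rewrite hermmapE mx33E.
  + by move=> b c /=; rewrite (triple_iso_mulr hT).
  + by move=> a c /=; rewrite (triple_iso_mul hT).
  + by move=> a b /=; rewrite (triple_iso_mulV hT) cddiamM cddiamK.
Qed.
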